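(* Let $d\ge 1$, let $\mathcal{X}\subset\mathbb{R}^d$, $\mathcal{Y}\subset\mathbb{R}$, $\mathcal{Z}=\mathcal{X}\times\mathcal{Y}$ and $\mathcal{H}=\mathbb{R}^d$ (linear models without intercept). Let $\ell:\mathcal{Z}\times\mathcal{H}\to\mathbb{R}$ be one of the following losses, where $z=(x,y)$: (i) the squared loss $\ell(z,h)=(x^T h-y)^2$; (ii) the absolute loss $\ell(z,h)=|x^T h-y|$; (iii) the hinge loss $\ell(z,h)=\max(0,1-y\,x^T h)$, in which case $\mathcal{Y}=\{-1,+1\}$. Let $A_{\mathrm{erm}}$ be the empirical risk minimizer over $\mathcal{H}$ for the loss $\ell$ (the minimum-norm minimizer being selected when the minimizer is not unique). Assume that $\mathcal{Y}$ contains at least one nonzero element. If there exists an open ball $B_0\subset\mathbb{R}^d$ that contains the origin and satisfies $B_0\subset\mathcal{X}$, then for every $N\in\mathbb{N}$, $A_{\mathrm{erm}}$ is not weakly $(\mathcal{Z},\ell,N)$-monotonic.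
   Context: $\mathbb{N}=\{1,2,\ldots\}$. Given a domain $\mathcal{Z}$, a hypothesis class $\mathcal{H}$ and a loss $\ell:\mathcal{Z}\times\mathcal{H}\to\mathbb{R}$, a learner is a map $A:\mathcal{Z}\cup\mathcal{Z}^2\cup\mathcal{Z}^3\cup\cdots\to\mathcal{H}$. For a probability distribution $D$ on $\mathcal{Z}$, the risk of $h\in\mathcal{H}$ is $R_D(h)=\mathbb{E}_{z\sim D}\,\ell(z,h)$. For a training set $S_n=(z_1,\ldots,z_n)\in\mathcal{Z}^n$, the empirical risk is $R_{S_n}(h)=\frac1n\sum_{i=1}^n\ell(z_i,h)$, and the empirical risk minimizer is $A_{\mathrm{erm}}(S_n)=\operatorname{argmin}_{h\in\mathcal{H}}R_{S_n}(h)$; if there are several minimizers, $A_{\mathrm{erm}}(S_n)$ is the one of minimum Euclidean norm. Local monotonicity: a learner $A$ is $(D,\ell,n)$-monotonic if $\mathbb{E}_{S_{n+1}\sim D^{n+1}}[R_D(A(S_{n+1}))-R_D(A(S_n))]\le 0$, where $S_{n+1}=(z_1,\ldots,z_{n+1})$ is i.i.d. from $D$ and $S_n=(z_1,\ldots,z_n)$. Local $\mathcal{Z}$-monotonicity: $A$ is locally $(\mathcal{Z},\ell,n)$-monotonic if it is $(D,\ell,n)$-monotonic for all distributions $D$ on $\mathcal{Z}$. Weak $\mathcal{Z}$-monotonicity: for $N\in\mathbb{N}$, $A$ is weakly $(\mathcal{Z},\ell,N)$-monotonic if for all integers $n\ge N$ it is locally $(\mathcal{Z},\ell,n)$-monotonic.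 *)

(* Defs.v *)
From HB Require Import structures.
From mathcomp Require Import all_boot all_order all_algebra.
From mathcomp Require Import all_classical all_reals all_analysis.

Set Implicit Arguments.
Unset Strict Implicit.
Unset Printing Implicit Defensive.
Import Order.TTheory GRing.Theory Num.Theory.
Import numFieldNormedType.Exports.
Local Open Scope classical_set_scope.
Local Open Scope ring_scope.

Section iid_sample.
Context d (T : measurableType d) (R : realType) (D : probability T R).

Let consp n (zs : T * n.-tuple T) : n.+1.-tuple T := [tuple of zs.1 :: zs.2].

Let measurable_consp n : measurable_fun setT (@consp n).
Proof. exact: measurable_cons measurable_fst measurable_snd. Qed.

HB.instance Definition _ n :=
  isMeasurableFun.Build _ _ _ _ (@consp n) (@measurable_consp n).

(* The power D^n: D^0 is the Dirac mass at the empty tuple, and D^(n+1) is the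
   image of the product D \x D^n under (z, s) |-> z :: s. *)
Fixpoint iid_power (n : nat) : probability (n.-tuple T) R :=
  match n with
  | 0 => \d_([tuple] : 0.-tuple T)
  | m.+1 => distribution (D \x iid_power m)%E (@consp m)
  end.

End iid_sample.

(* S_n = (z_1, ..., z_n) out of S_(n+1) = (z_1, ..., z_(n+1)) *)
Definition prefix_sample T n (S : n.+1.-tuple T) : n.-tuple T :=
  [tuple tnth S (widen_ord (leqnSn n) i) | i < n].

(* The component at n = 0 carries no meaning: monotonicity is only ever
   considered for n >= 1. *)
Definition learner (T H : Type) := forall n, n.-tuple T -> H.

Section monotonicity.
Context d (T : measurableType d) (R : realType) (H : Type).
Implicit Types (loss : T -> H -> R) (A : learner T H) (Z : set T).

Definition risk (D : probability T R) loss (h : H) : \bar R :=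
  'E_D[fun z => loss z h].

Definition empirical_risk loss n (S : n.-tuple T) (h : H) : R :=
  n%:R^-1 * \sum_(i < n) loss (tnth S i) h.

(* Risks may be infinite.  In \bar R, +oo - +oo = -oo, so an expected
   difference that is undefined never counts as positive. *)
Definition monotonic (D : probability T R) loss (n : nat) A : Prop :=
  (\int[iid_power D n.+1]_S
     (risk D loss (A n.+1 S) - risk D loss (A n (prefix_sample S))) <= 0)%E.

(* The probability measures on Z with the trace sigma-algebra are exactly the
   traces of the probability measures on T for which Z has full outer measure;
   Z itself need not be measurable.  For measurable Z this says D Z = 1. *)
Definition distribution_on Z (D : probability T R) : Prop :=
  forall E, measurable E -> E `&` Z = set0 -> D E = 0%E.

Definition locally_monotonic Z loss (n : nat) A : Prop :=
  forall D : probability T R, distribution_on Z D -> monotonic D loss n A.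

Definition weakly_monotonic Z loss (N : nat) A : Prop :=
  forall n, (N <= n)%N -> locally_monotonic Z loss n A.

End monotonicity.

Section linear_models.
Context (R : realType) (d : nat).

(* R^d with its Borel sigma-algebra; convertible to 'cV[R]_d *)
Definition borel_cV := g_sigma_algebraType (@open 'cV[R]_d).

Definition labelled := (borel_cV * measurableTypeR R)%type.

Definition dotp (x h : 'cV[R]_d) : R := (x^T *m h) 0 0.

(* The library's norm on matrices is the sup norm. *)
Definition eucl_norm (x : 'cV[R]_d) : R := Num.sqrt (dotp x x).

Definition eucl_ball (c : 'cV[R]_d) (r : R) : set 'cV[R]_d :=
  [set x | eucl_norm (x - c) < r].

Definition squared_loss (z : labelled) (h : 'cV[R]_d) : R :=
  (dotp z.1 h - z.2) ^+ 2.

Definition absolute_loss (z : labelled) (h : 'cV[R]_d) : R :=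
  `|dotp z.1 h - z.2|.

Definition hinge_loss (z : labelled) (h : 'cV[R]_d) : R :=
  Num.max 0 (1 - z.2 * dotp z.1 h).

Definition empirical_minimizers (loss : labelled -> 'cV[R]_d -> R) n
    (S : n.-tuple labelled) : set 'cV[R]_d :=
  [set h | forall h', empirical_risk loss S h <= empirical_risk loss S h'].

(* For the three losses above the set of minimizers is a nonempty closed convex
   set, so its element of minimum norm exists and is unique. *)
Definition A_erm (loss : labelled -> 'cV[R]_d -> R) :
    learner labelled 'cV[R]_d :=
  fun n S => get [set h | empirical_minimizers loss S h /\
    forall h', empirical_minimizers loss S h' -> eucl_norm h <= eucl_norm h'].

End linear_models.

(* Main.v *)
(* Put mass 1 - p on a = (rho e_1, y) and a small mass p on b = (- t rho e_1, y)
   with t = 2n.  To first order in p only samples with at most one copy of b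
   matter.  Samples without b are fitted exactly at a, so the learner is hurt
   at a only when b shows up: with m points this happens with probability m p,
   at a cost L_m.  The expected increase of the risk from n to n + 1 points is
   therefore p ((n+1) L_(n+1) - n L_n) + O(p^2).  As b is far away, a single
   copy of it (nearly) dictates the minimizer, so L_(n+1) is equal or close to
   L_n and the bracket is positive. *)

Require Import Defs.
From HB Require Import structures.
From mathcomp Require Import all_boot all_order all_algebra.
From mathcomp Require Import all_classical all_reals all_analysis.
From mathcomp Require Import measurable_realfun ring lra.
Set Implicit Arguments.
Unset Strict Implicit.
Unset Printing Implicit Defensive.
Import Order.TTheory GRing.Theory Num.Theory.
Import numFieldNormedType.Exports HBNNSimple.
Local Open Scope classical_set_scope.
Local Open Scope ring_scope.

(** * Integrals against a probability measure of finite support *)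

Section finite_support.
Context d (T : measurableType d) (R : realType).

Lemma finite_set_measurable_fun d' (T' : measurableType d') (F : set T)
    (f : T -> T') :
  (forall x : T, measurable [set x]) -> finite_set F -> measurable_fun F f.
Proof.
move=> m1 finF _ Y _; apply: countable_measurable => //.
by apply/finite_set_countable/(sub_finite_set _ finF) => x [].
Qed.

(* The integrand may be non-measurable: the integral is a supremum over the
   simple functions below it, and these are measurable. *)
Lemma integral_conull (mu : {measure set T -> \bar R}) (F : set T)
    (f : T -> \bar R) :
  measurable F -> mu (~` F) = 0%E -> measurable_fun F f ->
  (\int[mu]_x f x = \int[mu]_(x in F) f x)%E.
Proof.
move=> mF muF mf.
have ge0_conull (g : T -> \bar R) : (forall x, 0 <= g x)%E ->
    measurable_fun F g -> (\int[mu]_x g x = \int[mu]_(x in F) g x)%E.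
  move=> g0 mg; rewrite [RHS]integral_mkcond.
  have gF0 x : (0 <= (g \_ F) x)%E by rewrite patchE; case: ifP.
  apply/eqP; rewrite eq_le; apply/andP; split; last first.
    rewrite !ge0_integralTE//; apply: le_ereal_sup => _ [h hg <-].
    exists h => //= x; apply: le_trans (hg x) _.
    by rewrite patchE; case: ifP.
  rewrite [leLHS]ge0_integralTE//; apply: ge_ereal_sup => _ [h hg <-].
  rewrite -integralT_nnsfun; apply: ae_ge0_le_integral => //.
  - by move=> x _; rewrite lee_fin; exact: fun_ge0.
  - exact/measurable_EFinP/measurable_funPT.
  - by apply/(measurable_restrictT _ mF).
  - exists (~` F); split => //; first exact: measurableC.
    move=> x /= hx Fx; apply: hx => _.
    by rewrite patchE mem_set.
rewrite integralE [RHS]integralE; congr (_ - _)%E; apply: ge0_conull => //.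
- exact: measurable_funepos.
- exact: measurable_funeneg.
Qed.

(** Covers arbitrary [f], as [A_erm], selected by choice, requires: on a finite set with measurable
    points every function is measurable, and the complement is null. *)
Lemma integral_finite_support (mu : probability T R)
    (I : finType) (x : I -> T) (f : T -> R) :
  (forall t : T, measurable [set t]) -> injective x ->
  mu (~` range x) = 0%E ->
  (\int[mu]_t (f t)%:E)%E = (\sum_i fine (mu [set x i]) * f (x i))%:E.
Proof.
move=> m1 injx mu0.
have finx : finite_set (range x) by exact: finite_image.
have mx : measurable (range x).
  exact/countable_measurable/finite_set_countable.
have mf : measurable_fun (range x) (EFin \o f).
  exact: finite_set_measurable_fun.
rewrite (integral_conull mx mu0 mf).
have rangeE : range x = \big[setU/set0]_(i <- index_enum I) [set x i].
  rewrite -bigcup_seq; apply/seteqP; split => [_ [i _ <-]|t [i _ ->]].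
    by exists i => //=; rewrite mem_index_enum.
  by exists i.
rewrite rangeE integral_bigsetU_EFin//; last 3 first.
- exact: index_enum_uniq.
- by move=> i j _ _ [t [-> /injx]].
- by rewrite -rangeE.
rewrite -sumEFin; apply: eq_bigr => i _.
rewrite (eq_integral (cst (f (x i))%:E)); last first.
  by move=> t; rewrite inE /= => ->.
rewrite (integral_cst mu (m1 (x i))) EFinM fineK; first exact: muleC.
exact: fin_num_measure.
Qed.

End finite_support.

(** * Boxes and single samples under the i.i.d. power *)

Section iid_power_theory.
Context d (T : measurableType d) (R : realType) (D : probability T R).

Lemma measurable_tuple_box n (A : 'I_n -> set T) :
  (forall i, measurable (A i)) ->
  measurable [set s : n.-tuple T | forall i, A i (tnth s i)].
Proof.
move=> mA.
rewrite [X in measurable X](_ : _ =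
    \bigcap_(i in [set: 'I_n]) ((@tnth n T)^~ i @^-1` A i)); last first.
  by apply/seteqP; split => s h i; [move=> _|]; exact: h.
apply: fin_bigcap_measurable => // i _.
by rewrite -[X in measurable X]setTI; exact: measurable_tnth.
Qed.

Lemma iid_power_box n (A : 'I_n -> set T) :
  (forall i, measurable (A i)) ->
  iid_power D n [set s | forall i, A i (tnth s i)] = (\prod_i D (A i))%E.
Proof.
elim: n A => [|n IHn] A mA.
  by rewrite big_ord0 /= diracE mem_set//= => -[].
have mA' i : measurable ((A \o lift ord0) i) by exact: mA.
rewrite big_ord_recl /= /pushforward -(IHn _ mA').
rewrite -product_measure1E//; last exact: measurable_tuple_box.
congr (_ _); apply/seteqP; split => -[z s] /=.
  move=> h; split=> [|i]; first exact: (h ord0).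
  by have := h (lift ord0 i); rewrite tnthS.
move=> [hz hs] i; case: (unliftP ord0 i) => [j|] ->//.
by rewrite tnthS; exact: hs.
Qed.

Lemma measurable_tuple_set1 n (s : n.-tuple T) :
  (forall t : T, measurable [set t]) -> measurable [set s].
Proof.
move=> m1; rewrite (_ : [set s] = [set s' : n.-tuple T | forall i,
    [set tnth s i] (tnth s' i)]); 
  first exact: (measurable_tuple_box (A := fun i => [set tnth s i])).
by apply/seteqP; split => [s' ->//|s' h]; apply: eq_from_tnth.
Qed.

Lemma iid_power_set1 n (s : n.-tuple T) :
  (forall t : T, measurable [set t]) ->
  iid_power D n [set s] = (\prod_i D [set tnth s i])%E.
Proof.
move=> m1; rewrite -(iid_power_box (A := fun i => [set tnth s i]))//.
congr (_ _).
by apply/seteqP; split => [s' ->//|s' h]; apply: eq_from_tnth.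
Qed.

End iid_power_theory.

(** The sum is a polynomial in [p] whose empty-set term vanishes. Dividing it by [p] gives [Q],
    whose value at 0 is the sum of [u] over singletons; continuity then gives positivity for small
    [p]. *)
Lemma first_order_positive (R : realType) m (u v : {set 'I_m} -> R) :
  u finset.set0 = 0 -> v finset.set0 = 0 -> 0 < \sum_i u [set i]%SET ->
  exists2 p : R, 0 < p < 1 &
    0 < \sum_(B : {set 'I_m})
      p ^+ #|B| * (1 - p) ^+ (m - #|B|) * ((1 - p) * u B + p * v B).
Proof.
move=> u0 v0 u1.
pose Q : {poly R} := \sum_(B : {set 'I_m} | B != finset.set0)
  'X^(#|B|.-1) * (1 - 'X) ^+ (m - #|B|) *
  ((1 - 'X) * (u B)%:P + 'X * (v B)%:P).
have Q0 : 0 < Q.[0].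
  rewrite /Q horner_sum; under eq_bigr do rewrite !hornerE.
  rewrite (eq_bigr (fun B : {set 'I_m} =>
    if #|B| == 1%N then u B else 0)); last first.
    move=> B B0; have [->|B1] := eqVneq #|B| 1%N.
      by rewrite /= expr0 subr0 expr1n !mul1r.
    have Bgt1 : (0 < #|B|.-1)%N.
      by move: B0 B1; rewrite -card_gt0; case: #|B| => [|[|]].
    by rewrite /= expr0n eqn0Ngt Bgt1 !mul0r.
  rewrite -big_mkcondr (eq_bigl (fun B : {set 'I_m} => #|B| == 1%N)).
    by rewrite big_cards1.
  by move=> B /=; rewrite -cards_eq0; case: #|B| => [|[|]].
have [e e0 Qe] : exists2 e : R, 0 < e & forall p, `|p| < e -> 0 < Q.[p].
  have /nbhs_ballP[e /= e0 he] : nbhs (0 : R) (fun p => 0 < Q.[p]).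
    apply: (@continuous_horner R Q 0 [set x | 0 < x]).
    by apply: open_nbhs_nbhs; split; [exact: open_gt|].
  by exists e => // p pe; apply: he; rewrite /ball /= sub0r normrN.
pose p := Num.min (2^-1) (e / 2) : R.
have p0 : 0 < p by rewrite lt_min invr_gt0 ltr0n /= divr_gt0.
have p1 : p < 1 by rewrite gt_min invf_lt1 ?ltr0n// ltr1n.
have pe : `|p| < e.
  rewrite gtr0_norm// gt_min [X in _ || X]ltr_pdivrMr//.
  by rewrite mulr_natr mulr2n ltrDl e0 orbT.
exists p; first by rewrite p0 p1.
rewrite [ltRHS](_ : _ = p * Q.[p]); first by rewrite mulr_gt0// Qe.
rewrite (bigD1 finset.set0)//= u0 v0 !mulr0 addr0 mulr0 add0r.
rewrite /Q horner_sum mulr_sumr; apply: eq_bigr => B B0.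
rewrite !hornerE /=; congr (_ * _ * _).
by rewrite -exprS prednK// card_gt0.
Qed.

(** * Two-point distributions as images of Bernoulli measures *)

Section two_points.
Context d (T : measurableType d) (R : realType).

Definition two_points (a b : T) (c : bool) : T := if c then b else a.

Let measurable_two_points a b : measurable_fun setT (two_points a b).
Proof. by []. Qed.

HB.instance Definition _ a b :=
  isMeasurableFun.Build _ _ _ _ (two_points a b) (@measurable_two_points a b).

Definition two_point_prob (p : R) (a b : T) : probability T R :=
  distribution (bernoulli_prob p) (two_points a b).

Lemma two_point_probE (p : R) a b (E : set T) : 0 <= p <= 1 ->
  two_point_prob p a b E = (p%:E * \d_b E + (1 - p)%:E * \d_a E)%E.
Proof.
by move=> p01; rewrite /two_point_prob/= /pushforward bernoulli_probE// !diracE.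
Qed.

Lemma two_point_prob_null (p : R) a b (E : set T) : ~ E a -> ~ E b ->
  two_point_prob p a b E = 0%E.
Proof.
move=> Ea Eb; rewrite /two_point_prob/= /pushforward.
by rewrite (_ : _ @^-1` E = set0) ?measure0// -subset0 => -[].
Qed.

Lemma two_point_prob_set1 (p : R) a b c : 0 <= p <= 1 -> a != b ->
  two_point_prob p a b [set two_points a b c] = (if c then p else 1 - p)%:E.
Proof.
move=> p01 ab; rewrite two_point_probE// !diracE.
by case: c; rewrite /= !in_set1 ?eqxx ?[b == a]eq_sym (negPf ab)
  ?(mule0, mule1) ?(adde0, add0e).
Qed.

End two_points.

(** * Samples from a two-point distribution *)

Section two_point_samples.
Context d (T : measurableType d) (R : realType) (H : Type).
Context (a b : T) (ab : a != b).
Context (measurable_set1T : forall t : T, measurable [set t]).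

(** [B] is the set of positions holding [b], so integrals over samples become the sums over subsets
    of [first_order_positive]. *)
Definition two_point_sample n (B : {set 'I_n}) : n.-tuple T :=
  [tuple two_points a b (i \in B) | i < n].

Lemma prefix_two_point_sample_widen n (i : 'I_n) :
  prefix_sample (two_point_sample [set widen_ord (leqnSn n) i]%SET) =
  two_point_sample [set i]%SET.
Proof. by apply: eq_from_tnth => j; rewrite !tnth_mktuple !inE. Qed.

Lemma prefix_two_point_sample_max n :
  prefix_sample (two_point_sample [set ord_max : 'I_n.+1]%SET) =
  two_point_sample finset.set0.
Proof.
apply: eq_from_tnth => j; rewrite !tnth_mktuple !inE.
by rewrite -val_eqE /= ltn_eqF.
Qed.

Lemma two_points_inj : injective (two_points a b).
Proof. by case=> -[]//= /eqP; rewrite 1?[b == a]eq_sym (negPf ab). Qed.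

Lemma two_point_sample_inj n : injective (@two_point_sample n).
Proof.
move=> B B' /(congr1 (fun s => tnth s)) BB'; apply/setP => i.
have := congr1 (@^~ i) BB'; rewrite !tnth_mktuple; exact: two_points_inj.
Qed.

Lemma range_two_point_sample n : range (@two_point_sample n) =
  [set s | forall i, range (two_points a b) (tnth s i)].
Proof.
apply/seteqP; split => [_ [B _ <-] i|s /= hs].
  by exists (i \in B) => //; rewrite tnth_mktuple.
exists [set i | tnth s i == b]%SET => //; apply: eq_from_tnth => i.
rewrite tnth_mktuple inE; have [[] _ <-] /= := hs i; first by rewrite eqxx.
by rewrite (negPf ab).
Qed.

Lemma measurable_range_two_points : measurable (range (two_points a b)).
Proof.
by apply: countable_measurable => //; exact/finite_set_countable/finite_image.
Qed.

(** The range is a box, and each of its sides has mass 1. *)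
Lemma iid_two_point_null (p : R) n :
  iid_power (two_point_prob p a b) n (~` range (@two_point_sample n)) = 0%E.
Proof.
have mR := measurable_range_two_points.
have D1 : two_point_prob p a b (range (two_points a b)) = 1%E.
  rewrite -[X in _ X = _]setCK probability_setC; last exact: measurableC.
  by rewrite two_point_prob_null ?sube0//= => -[]; [exists false|exists true].
rewrite range_two_point_sample probability_setC; last first.
  exact: (measurable_tuple_box (A := fun=> range (two_points a b))).
rewrite (iid_power_box _ (A := fun=> range (two_points a b)))// big1 ?subee//.
Qed.

Lemma iid_two_point_set1 (p : R) n (B : {set 'I_n}) : 0 <= p <= 1 ->
  iid_power (two_point_prob p a b) n [set two_point_sample B] =
  (p ^+ #|B| * (1 - p) ^+ (n - #|B|))%:E.
Proof.
move=> p01; rewrite iid_power_set1//.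
under eq_bigr do rewrite tnth_mktuple two_point_prob_set1//.
rewrite prodEFin; congr EFin.
rewrite (bigID (mem B))/= (eq_bigr (fun=> p)); last by move=> i ->.
rewrite [X in _ * X](eq_bigr (fun=> 1 - p)); last by move=> i /negPf ->.
rewrite !prodr_const; congr (_ * _ ^+ _).
by rewrite -[X in (X - _)%N]card_ord -(cardC B) addKn.
Qed.

Lemma risk_two_point (loss : T -> H -> R) (p : R) (h : H) : 0 <= p <= 1 ->
  risk (two_point_prob p a b) loss h = ((1 - p) * loss a h + p * loss b h)%:E.
Proof.
move=> p01; rewrite /risk unlock (integral_finite_support _ _ two_points_inj)//.
  under eq_bigr do rewrite two_point_prob_set1//=.
  by rewrite big_bool/= addrC.
by rewrite two_point_prob_null//= => -[]; [exists false|exists true].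
Qed.

(** The expected risk difference is the sum of [first_order_positive], with the increments of the
    loss at [a] and at [b] as [u] and [v]. The first hypothesis removes the empty-set term; the
    second is positivity of the first-order coefficient. *)
Lemma not_monotonic_two_point (loss : T -> H -> R) (A : learner T H) n :
  (forall c, loss (two_points a b c) (A n.+1 (two_point_sample finset.set0)) =
             loss (two_points a b c) (A n (two_point_sample finset.set0))) ->
  0 < \sum_(i < n.+1) (loss a (A n.+1 (two_point_sample [set i]%SET)) -
        loss a (A n (prefix_sample (two_point_sample [set i]%SET)))) ->
  exists p : R, ~ monotonic (two_point_prob p a b) loss n A.
Proof.
move=> loss0 loss1.
pose diff z B := loss z (A n.+1 (two_point_sample B)) -
  loss z (A n (prefix_sample (two_point_sample B))).
have diff0 c : diff (two_points a b c) finset.set0 = 0.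
  rewrite /diff loss0; apply/eqP; rewrite subr_eq0; apply/eqP.
  congr (loss _ (A n _)); apply: eq_from_tnth => i.
  by rewrite !tnth_mktuple !inE.
have [p /andP[p0 p1] hp] :=
  first_order_positive (diff0 false) (diff0 true) loss1.
exists p; apply/negP; rewrite -ltNge.
have p01 : 0 <= p <= 1 by rewrite !ltW.
rewrite (eq_integral (fun S => ((1 - p) *
    (loss a (A n.+1 S) - loss a (A n (prefix_sample S))) + p *
    (loss b (A n.+1 S) - loss b (A n (prefix_sample S))))%:E)); last first.
  move=> S _; rewrite !risk_two_point// -EFinB; congr EFin.
  by rewrite !mulrBr; ring.
rewrite (integral_finite_support _ _ (@two_point_sample_inj n.+1));
  last 2 first.
- by move=> s; exact: measurable_tuple_set1.
- exact: iid_two_point_null.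
rewrite lte_fin; under eq_bigr do rewrite iid_two_point_set1//=.
exact: hp.
Qed.

End two_point_samples.

(** * Reduction of empirical risk minimization to one coordinate *)

Section erm.
Context (R : realType) (d : nat).
Implicit Types (h : 'cV[R]_d) (g : R -> R).

(** Strictness of the norm comparison makes [u] unique, so it can identify the value that [get]
    returns in [A_erm]. *)
Definition min_norm_minimizer g (u : R) := forall u',
  g u <= g u' /\ (g u' <= g u -> u' = u \/ `|u| < `|u'|).

(** Scaling the variable preserves the order of absolute values, so the losses may be studied with
    [a] normalized to sit at 1. *)
Lemma min_norm_minimizerZ g (c k u : R) : 0 < c -> k != 0 ->
  min_norm_minimizer g u ->
  min_norm_minimizer (fun v => c * g (k * v)) (u / k).
Proof.
move=> c0 k0 gu v; rewrite mulrCA divff// mulr1 !ler_pM2l//.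
have [gle gsel] := gu (k * v); split=> // /gsel [<-|uv].
  by left; rewrite mulrAC divff// mul1r.
by right; rewrite normrM normfV ltr_pdivrMr ?normr_gt0// -normrM mulrC.
Qed.

Lemma dotp_delta h (i : 'I_d) (r : R) :
  dotp (r *: delta_mx i 0) h = r * h i 0.
Proof.
rewrite /dotp linearZ/= -scalemxAl mxE trmx_delta -rowE mxE.
by [].
Qed.

Lemma dotpp h : dotp h h = \sum_i h i 0 ^+ 2.
Proof. by rewrite /dotp mxE; apply: eq_bigr => i _; rewrite mxE expr2. Qed.

Lemma eucl_norm_delta (i : 'I_d) (r : R) : eucl_norm (r *: delta_mx i 0) = `|r|.
Proof.
by rewrite /eucl_norm dotp_delta !mxE !eqxx mulr1 -expr2 sqrtr_sqr.
Qed.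

Lemma ler_coord_eucl_norm h (i : 'I_d) : `|h i 0| <= eucl_norm h.
Proof.
rewrite -sqrtr_sqr ler_wsqrtr// dotpp (bigD1 i)//= lerDl.
by apply: sumr_ge0 => j _; exact: sqr_ge0.
Qed.

(* The minimizer u on the line spanned by e_i gives the minimizer u e_i of
   minimum norm, and |h_i| <= |h| pins down the i-th coordinate of any other
   candidate. *)
Lemma A_erm_coord (loss : labelled R d -> 'cV[R]_d -> R) n
    (S : n.-tuple (labelled R d)) g (i : 'I_d) (u : R) :
  (forall h, empirical_risk loss S h = g (h i 0)) ->
  min_norm_minimizer g u -> A_erm loss S i 0 = u.
Proof.
move=> riskE gu; rewrite /A_erm.
set P := [set h | _].
have coord r : (r *: delta_mx i 0 : 'cV[R]_d) i 0 = r.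
  by rewrite !mxE !eqxx mulr1.
have Pu : P (u *: delta_mx i 0).
  split => [h|h hmin]; first by rewrite !riskE coord; exact: (gu _).1.
  rewrite eucl_norm_delta; apply: le_trans (ler_coord_eucl_norm h i).
  have := hmin (u *: delta_mx i 0); rewrite !riskE coord => /(gu _).2.
  by case=> [->//|/ltW].
have [hmin hnorm] : P (get P) := getI Pu.
have := hmin (u *: delta_mx i 0); rewrite !riskE coord => /(gu _).2.
case=> // hu; have := hnorm _ Pu.1; rewrite eucl_norm_delta leNgt.
by rewrite (lt_le_trans hu (ler_coord_eucl_norm _ i)).
Qed.

Lemma empirical_risk_two_points (loss : labelled R d -> 'cV[R]_d -> R) a b n
    (B : {set 'I_n}) h :
  empirical_risk loss (two_point_sample a b B) h =
  n%:R^-1 * ((n - #|B|)%:R * loss a h + #|B|%:R * loss b h).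
Proof.
rewrite /empirical_risk; congr (_ * _).
under eq_bigr do rewrite tnth_mktuple.
rewrite (bigID (mem B))/= addrC (eq_bigr (fun=> loss a h)); last first.
  by move=> i /negPf ->.
rewrite [X in _ + X](eq_bigr (fun=> loss b h)); last by move=> i ->.
rewrite !sumr_const -(mulr_natl (loss a h)) -(mulr_natl (loss b h)).
congr (_%:R * _ + _).
by rewrite -[X in (X - _)%N]card_ord -(cardC B) addKn.
Qed.

(** In the coordinate [v = k * h i 0], a sample without [b] is fitted by 1, at no loss at [a], and
    [m] copies of [a] with one [b] are fitted by [w m]. The last hypothesis is then the first-order
    condition of [not_monotonic_two_point]. *)
Lemma erm_not_monotonic (loss : labelled R d -> 'cV[R]_d -> R) a b n
    (i : 'I_d) (f : R -> R) (c k t : R) (w : nat -> R) :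
  a != b -> (forall z : labelled R d, measurable [set z]) -> (0 < n)%N ->
  0 < c -> k != 0 ->
  (forall h, loss a h = c * f (k * h i 0)) ->
  (forall h, loss b h = c * f (- t * (k * h i 0))) ->
  min_norm_minimizer f 1 -> f 1 = 0 ->
  (forall j, (j <= n)%N ->
    min_norm_minimizer (fun v => j%:R * f v + f (- t * v)) (w j)) ->
  n%:R * f (w n.-1) < n.+1%:R * f (w n) ->
  exists p : R, ~ monotonic (two_point_prob p a b) loss n (A_erm loss).
Proof.
move=> ab m1 n0 c0 k0 la lb f1 f10 fw wn.
have erm0 m : (0 < m)%N ->
    A_erm loss (two_point_sample a b (finset.set0 : {set 'I_m})) i 0 = 1 / k.
  move=> m0; apply: (A_erm_coord (g := fun v => c * f (k * v))); last first.
    exact: min_norm_minimizerZ.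
  move=> h; rewrite empirical_risk_two_points cards0 subn0 mul0r addr0.
  rewrite mulKf ?la//.
  by rewrite pnatr_eq0 -lt0n.
have erm1 m (j : 'I_m.+1) : (m <= n)%N ->
    A_erm loss (two_point_sample a b [set j]%SET) i 0 = w m / k.
  move=> mn; apply: (A_erm_coord (g := fun v => (m.+1%:R^-1 * c) *
      (m%:R * f (k * v) + f (- t * (k * v))))); last first.
    by apply: min_norm_minimizerZ (fw _ mn) => //; rewrite mulr_gt0.
  move=> h; rewrite empirical_risk_two_points cards1 subSS subn0 la lb.
  by rewrite mul1r; ring.
have la1 h : h i 0 = 1 / k -> loss a h = 0.
  by move=> hi; rewrite la hi mul1r divff// f10 mulr0.
have law m h : h i 0 = w m / k -> loss a h = c * f (w m).
  by move=> hi; rewrite la hi mulrCA divff// mulr1.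
apply: not_monotonic_two_point => //.
  by case=> /=; rewrite ?la ?lb !erm0.
(* If [b] comes last, the prefix misses it and has loss 0 at [a]. For each of the other [n]
   positions the prefix keeps [b] and only [n.-1] copies of [a]. *)
rewrite big_ord_recr /= (law n) ?erm1// prefix_two_point_sample_max.
rewrite (la1 (A_erm _ _)) ?erm0// subr0.
rewrite (eq_bigr (fun=> c * (f (w n) - f (w n.-1)))); last first.
  move=> j _; rewrite prefix_two_point_sample_widen (law n) ?erm1// mulrBr.
  congr (_ - _); case: n n0 fw wn j erm1 {erm0} => // m _ fw wn j erm1.
  by rewrite (law m)// erm1.
rewrite sumr_const card_ord -(mulr_natl (c * _)).
have -> : n%:R * (c * (f (w n) - f (w n.-1))) + c * f (w n) =
  c * (n.+1%:R * f (w n) - n%:R * f (w n.-1)) by rewrite -natr1; ring.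
by rewrite mulr_gt0// subr_gt0.
Qed.

Lemma eucl_ball_delta (z : 'cV[R]_d) (r : R) (i : 'I_d) :
  eucl_ball z r 0 ->
  exists2 e : R, 0 < e &
    forall s, `|s| <= e -> eucl_ball z r (s *: delta_mx i 0).
Proof.
rewrite /eucl_ball /= => z0.
have normE s : eucl_norm (s *: delta_mx i 0 - z) ^+ 2 =
    s ^+ 2 - 2 * s * z i 0 + dotp z z.
  have ge0 h : 0 <= dotp h h by rewrite dotpp sumr_ge0// => j _; exact: sqr_ge0.
  rewrite /eucl_norm sqr_sqrtr// !dotpp (bigD1 i)//= [in RHS](bigD1 i)//=.
  rewrite !mxE !eqxx /= mulr1 addrA; congr (_ + _); first by ring.
  by apply: eq_bigr => j ji; rewrite !mxE (negPf ji) andbT mulr0 sub0r sqrrN.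
have r0 : 0 < r by apply: le_lt_trans z0; exact: sqrtr_ge0.
have gap : 0 < r ^+ 2 - dotp z z.
  have <- : eucl_norm (0 - z) ^+ 2 = dotp z z.
    by rewrite -(scale0r (delta_mx i 0)) normE; ring.
  by rewrite subr_gt0 ltr_pXn2r// nnegrE ?sqrtr_ge0 ?ltW.
set g := r ^+ 2 - dotp z z in gap.
pose M := 1 + 2 * `|z i 0|.
have M0 : 0 < M by rewrite /M; have := normr_ge0 (z i 0); lra.
(* This bound is at most 1, whence [s ^+ 2] is at most the absolute value of [s], and its product
   with [M] stays below the gap [g]; so [s ^+ 2 - 2 * s * z i 0] is below [g]. *)
exists (g / (g + M)); first by rewrite divr_gt0// addr_gt0.
move=> s hs; rewrite -(@ltr_pXn2r _ 2)// ?nnegrE ?sqrtr_ge0 ?ltW// normE.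
have s1 : `|s| <= 1.
  apply: le_trans hs _; rewrite ler_pdivrMr; last exact: addr_gt0.
  by rewrite mul1r lerDl ltW.
have sM : `|s| * M < g.
  apply: (@le_lt_trans _ _ (g / (g + M) * M)); first by rewrite ler_pM2r.
  by rewrite mulrAC ltr_pdivrMr; [rewrite ltr_pM2l// ltrDr|exact: addr_gt0].
have s2 : s ^+ 2 <= `|s|.
  by rewrite -[s ^+ 2]real_normK ?num_real// expr2 ler_piMr.
have : - (s * z i 0) <= `|s| * `|z i 0| by rewrite -normrM -normrN ler_norm.
by move: sM; rewrite /g /M => ? ?; lra.
Qed.

Lemma measurable_labelled_set1 (z : labelled R d) :
  (0 < d)%N -> measurable [set z].
Proof.
move=> d0; case: z => x y.
rewrite (_ : [set (x, y)] = [set x] `*` [set y]); last first.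
  by apply/seteqP; split => [_ ->//|[x' y'] [/= -> ->]].
apply: measurableX; last exact: measurable_set1.
rewrite -[[set x]]setCK; apply: measurableC; apply: sub_sigma_algebra.
apply: closed_openC; case: d d0 x => // d' _ x.
exact/accessible_closed_set1/hausdorff_accessible/norm_hausdorff.
Qed.

End erm.

(** * The squared, absolute and hinge losses on the line *)

Section one_dimensional_losses.
Context (R : realType) (n : nat) (n0 : (0 < n)%N).
Let t : R := 2 * n%:R.

Let n1 : 1 <= n%:R :> R. Proof. by rewrite ler1n. Qed.
Let t0 : 0 < t. Proof. by rewrite mulr_gt0// (lt_le_trans ltr01). Qed.
Let j_le j : (j <= n)%N -> 0 <= (j%:R : R) <= n%:R.
Proof. by move=> jn; rewrite ler0n ler_nat. Qed.

(* In the coordinate where a sits at 1 and b at - t, [w j] is the minimizer for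
   j copies of a and one copy of b.  For the absolute and hinge losses t > n
   forces w = - 1 / t; the squared loss needs t of order n. *)
Definition harmful (f : R -> R) := [/\ min_norm_minimizer f 1, f 1 = 0 &
  exists2 w : nat -> R,
    forall j, (j <= n)%N ->
      min_norm_minimizer (fun v => j%:R * f v + f (- t * v)) (w j) &
    n%:R * f (w n.-1) < n.+1%:R * f (w n)].

Lemma harmful_squared : harmful (fun v => (v - 1) ^+ 2).
Proof.
split=> [v||].
- rewrite subrr expr0n/= sqr_ge0; split=> // v1; left.
  by apply/eqP; rewrite -subr_eq0 -sqrf_eq0 eq_le v1 sqr_ge0.
- by rewrite subrr expr0n.
(* The zero of the derivative; completing the square around it shows that it is the only
   minimizer. *)
exists (fun j => (j%:R - t) / (j%:R + t ^+ 2)) => [j jn v|].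
  have /andP[j0 _] := j_le jn; set w := _ / _.
  have a0 : 0 < j%:R + t ^+ 2 by rewrite ltr_wpDl// exprn_gt0.
  have -> : j%:R * (v - 1) ^+ 2 + (- t * v - 1) ^+ 2 =
      j%:R * (w - 1) ^+ 2 + (- t * w - 1) ^+ 2 +
      (j%:R + t ^+ 2) * (v - w) ^+ 2.
    by rewrite /w; field; rewrite gt_eqF.
  rewrite lerDl mulr_ge0 ?sqr_ge0 ?(ltW a0)//; split=> //.
  rewrite gerDl pmulr_rle0// => vw; left.
  by apply/eqP; rewrite -subr_eq0 -sqrf_eq0 eq_le vw sqr_ge0.
have lossE j : (0 <= j :> R) -> ((j - t) / (j + t ^+ 2) - 1) ^+ 2 =
    (t * (1 + t)) ^+ 2 / (j + t ^+ 2) ^+ 2.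
  move=> j0; field; rewrite gt_eqF//.
  by rewrite ltr_wpDl// exprn_gt0.
have frac_lt (a p q X Y : R) : 0 < a -> 0 < X -> 0 < Y -> p * Y < q * X ->
    p * (a / X) < q * (a / Y).
  move=> a0 X0 Y0 pq; rewrite !mulrA ltr_pdivrMr// [ltRHS]mulrAC ltr_pdivlMr//.
  by rewrite -mulrA mulrCA -[ltRHS]mulrA [ltRHS]mulrCA ltr_pM2l.
have j2_gt0 (j : R) : 0 <= j -> 0 < (j + t ^+ 2) ^+ 2.
  by move=> j0; rewrite exprn_gt0// ltr_wpDl// exprn_gt0.
rewrite !lossE//; apply: frac_lt; rewrite ?j2_gt0//.
  by rewrite exprn_gt0// mulr_gt0// addr_gt0.
have -> : n.-1%:R = n%:R - 1 :> R by rewrite -[in RHS](prednK n0) -natr1 addrK.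
rewrite -natr1 /t; have x1 := n1; move: n%:R x1 => x x1.
rewrite -subr_gt0.
(* The cross-multiplied inequality at [x = n], [t = 2 * x], rearranged so that every summand is
   visibly nonnegative for [x >= 1]. *)
have -> : (x + 1) * (x - 1 + (2 * x) ^+ 2) ^+ 2 - x * (x + (2 * x) ^+ 2) ^+ 2 =
  (x + 1) + (x + 4 * x ^+ 2) * (4 * x * (x - 1) + (3 * x - 2)) by ring.
have x0 : 0 <= x by lra.
have xx : 0 <= x * (x - 1) by rewrite mulr_ge0//; lra.
apply: ltr_pwDl; [lra | apply: mulr_ge0; last by lra].
by rewrite addr_ge0// mulr_ge0// sqr_ge0.
Qed.

Lemma harmful_absolute : harmful (fun v => `|v - 1|).
Proof.
split=> [v||].
- rewrite subrr normr0 normr_ge0; split=> //.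
  by rewrite normr_le0 subr_eq0 => /eqP; left.
- by rewrite subrr normr0.
have tw : - t * - t^-1 = 1 by rewrite mulrNN divff ?gt_eqF.
exists (fun=> - t^-1) => [j jn v|].
  have /andP[j0 jx] := j_le jn.
  have -> : `|- t * v - 1| = t * `|v - - t^-1|.
    by rewrite -[X in X * `|_|](gtr0_norm t0) -normrM -normrN; congr `|_|;
       field; rewrite gt_eqF.
  rewrite tw subrr normr0 addr0; set w := - t^-1.
  have tri : `|w - 1| <= `|v - 1| + `|v - w|.
    rewrite (distrC v w) [leRHS]addrC (le_trans _ (ler_normD _ _))//.
    by rewrite addrA subrK.
  (* The [b] term has slope [t = 2 * n]: at most [n] of it offsets the [j] copies of [a], and the
     remaining [n] makes the minimum strict. *)
  have low : j%:R * `|w - 1| + n%:R * `|v - w| <=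
      j%:R * `|v - 1| + t * `|v - w|.
    have := normr_ge0 (v - w); rewrite /t; nra.
  have vw0 := normr_ge0 (v - w).
  have nvw : `|v - w| <= n%:R * `|v - w| by rewrite ler_peMl.
  split=> [|hle]; first by lra.
  by left; apply/eqP; rewrite -subr_eq0 -normr_eq0 eq_le vw0 andbT; lra.
(* As [w] is constant, only [n < n.+1] and a positive loss at [w] are at stake. *)
rewrite ltr_pM2r ?ltr_nat// normr_gt0 subr_eq0 lt_eqF//.
by rewrite (lt_trans _ ltr01)// oppr_lt0 invr_gt0.
Qed.

Lemma harmful_hinge : harmful (fun v => Num.max 0 (1 - v)).
Proof.
have max0 : Num.max 0 (1 - 1) = 0 :> R by rewrite subrr maxxx.
split=> // [v|].
  (* Every [v >= 1] is a minimizer; the norm selects 1. *)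
  rewrite max0 le_max lexx; split=> //; rewrite ge_max subr_le0 => /andP[_].
  rewrite le_eqVlt => /predU1P[->|v1]; [by left|right].
  by rewrite normr1 gtr0_norm// (lt_trans ltr01).
have tw : - t * - t^-1 = 1 by rewrite mulrNN divff ?gt_eqF.
have w0 : - t^-1 < 0 by rewrite oppr_lt0 invr_gt0.
exists (fun=> - t^-1) => [j jn v|].
  have /andP[j0 jx] := j_le jn.
  rewrite tw max0 addr0 (_ : 1 - - t * v = 1 + t * v); last by ring.
  set w := - t^-1 in tw w0 *.
  have -> : Num.max 0 (1 - w) = 1 - w by apply/max_idPr; lra.
  have v1 : 1 - v <= Num.max 0 (1 - v) by rewrite le_max lexx orbT.
  have tv0 : 0 <= Num.max 0 (1 + t * v) by rewrite le_max lexx.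
  have tv1 : t * (v - w) <= Num.max 0 (1 + t * v).
    by rewrite le_max; apply/orP; right; rewrite -tw; nra.
  (* Left of [w] the [b] term is already zero and the [a] term does not decrease as [v] moves away.
     Ties occur there for [j = 0], and the norm settles them since [w < 0]. Right of [w] the slope
     argument for the absolute loss applies. *)
  have [vw|vw] := ltP v w.
    split; last by right; rewrite !ltr0_norm ?ltrN2// (lt_trans vw).
    by nra.
  have low : j%:R * (1 - w) + n%:R * (v - w) <=
      j%:R * Num.max 0 (1 - v) + Num.max 0 (1 + t * v).
    by move: tv1; rewrite /t; nra.
  have nvw : v - w <= n%:R * (v - w) by rewrite ler_peMl// subr_ge0.
  split=> [|hle]; first by lra.
  by left; apply/eqP; rewrite eq_le vw andbT; lra.
by rewrite ltr_pM2r ?ltr_nat// lt_max; apply/orP; right; lra.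
Qed.

End one_dimensional_losses.

Theorem theorem2 (R : realType) (d : nat) (hd : (1 <= d)%N)
    (X : set 'cV[R]_d) (Y : set R)
    (loss : labelled R d -> 'cV[R]_d -> R)
    (hloss : [\/ loss = @squared_loss R d,
                 loss = @absolute_loss R d |
                 loss = @hinge_loss R d /\ Y = [set -1; 1]])
    (hY : exists2 y, Y y & y != 0)
    (hX : exists c r, eucl_ball c r 0 /\ eucl_ball c r `<=` X)
    (N : nat) (hN : (1 <= N)%N) :
  ~ weakly_monotonic (X `*` Y : set (labelled R d)) loss N (A_erm loss).
Proof.
move=> mono; have [y Yy y0] := hY; have [z [r [z0 zX]]] := hX.
(* Monotonicity is refuted at [n = N] itself, with both atoms on the first axis. *)
pose i : 'I_d := Ordinal hd; pose t : R := 2 * N%:R.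
have t0 : 0 < t by rewrite mulr_gt0// ltr0n.
have [e e0 ballX] := eucl_ball_delta i z0.
(* Small enough that both [atom 1] and [atom (- t)] lie on the segment inside the ball. *)
pose rho := e / (1 + t).
have rho0 : 0 < rho by rewrite divr_gt0// addr_gt0.
pose atom s : labelled R d := ((s * rho) *: delta_mx i 0, y).
have atomX s : `|s| <= 1 + t -> (X `*` Y) (atom s).
  move=> st; split=> //; apply: zX; apply: ballX.
  rewrite normrM (gtr0_norm rho0) mulrA ler_pdivrMr ?addr_gt0//.
  by rewrite mulrC ler_pM2l.
(* Writing [v = rho / y * h i 0], the prediction at [atom s] is [y * (s * v)]. The label thus
   factors out of the squared and absolute losses as [c], and cancels in the hinge loss because
   [y * y = 1]. *)
have [f [c [fN c0 lossE]]] : exists f c, [/\ harmful N f, 0 < c &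
    forall s h, loss (atom s) h = c * f (s * (rho / y * h i 0))].
  have dotE s h : dotp (atom s).1 h = y * (s * (rho / y * h i 0)).
    by rewrite dotp_delta; field.
  case: hloss => [->|->|[-> YE]].
  - exists (fun v => (v - 1) ^+ 2), (y ^+ 2); split.
    + exact: harmful_squared.
    + by rewrite exprn_even_gt0.
    + by move=> s h; rewrite /squared_loss dotE/=; ring.
  - exists (fun v => `|v - 1|), `|y|; split.
    + exact: harmful_absolute.
    + by rewrite normr_gt0.
    + by move=> s h; rewrite /absolute_loss dotE/= -normrM mulrBr mulr1.
  - exists (fun v => Num.max 0 (1 - v)), 1; split=> //.
    + exact: harmful_hinge.
    + move=> s h; rewrite /hinge_loss dotE/= mul1r mulrA.
      have -> : y * y = 1.
        by move: Yy; rewrite YE => -[] ->; rewrite ?mulrNN mulr1.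
      by rewrite mul1r.
have [f1 f10 [w fw wN]] := fN.
have [p] : exists p, ~ monotonic (two_point_prob p (atom 1) (atom (- t)))
    loss N (A_erm loss).
  apply: (erm_not_monotonic (f := f) (c := c) (k := rho / y) (t := t)
    (i := i) (w := w)) => //.
  - apply/eqP => /(congr1 (fun x : labelled R d => x.1 i 0)) /=.
    rewrite !mxE !eqxx/= !mulr1 mul1r => /eqP; rewrite gt_eqF//.
    by rewrite (lt_trans _ rho0)// mulNr oppr_lt0 mulr_gt0.
  - by move=> x; exact: measurable_labelled_set1.
  - by rewrite mulf_neq0 ?invr_neq0// gt_eqF.
  - by move=> h; rewrite lossE mul1r.
(* A measurable set disjoint from the domain misses both atoms, so it is null. *)
apply; apply: mono => // E mE EXY; apply: two_point_prob_null => Ez.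
- suff: (E `&` (X `*` Y)) (atom 1) by rewrite EXY.
  by split=> //; apply: atomX; rewrite normr1 lerDl ltW.
- suff: (E `&` (X `*` Y)) (atom (- t)) by rewrite EXY.
  by split=> //; apply: atomX; rewrite normrN gtr0_norm// lerDr.
Qed.
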